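(* Let $A\in\mathbb{R}^{n\times n}$, $B\in\mathbb{R}^{n\times p}$, $C\in\mathbb{R}^{p\times n}$. Let $\mathbb{V}_m=[V_1,\dots,V_m]$ and $\mathbb{W}_m=[W_1,\dots,W_m]$, with $V_i,W_i\in\mathbb{R}^{n\times s}$, have full rank and satisfy $\mathbb{W}_m^T\mathbb{V}_m=I_{ms}$. Set $A_m=\mathbb{W}_m^TA\mathbb{V}_m$, $B_m=\mathbb{W}_m^TB$, $C_m=C\mathbb{V}_m$, and $$H(\omega)=C(\omega I_n-A)^{-1}B,\qquad H_m(\omega)=C_m(\omega I_{ms}-A_m)^{-1}B_m.$$ Let $\sigma,\mu\in\mathbb{C}$ be such that $\omega I_n-A$ and $\omega I_{ms}-A_m$ are invertible for $\omega=\sigma,\mu$. Let $R=[r_1,\dots,r_s]$, $L=[l_1,\dots,l_s]\in\mathbb{R}^{p\times s}$. Then: 1. If $(\sigma I_n-A)^{-1}Br_i\in\mathrm{Range}\{V_1,\dots,V_m\}$ for $i=1,\dots,s$, then $H_m(\sigma)R=H(\sigma)R$. 2. If $(\mu I_n-A)^{-T}C^Tl_i\in\mathrm{Range}\{W_1,\dots,W_m\}$ for $i=1,\dots,s$, then $L^TH_m(\mu)=L^TH(\mu)$. 3. If the hypotheses of both 1 and 2 hold and in addition $\sigma=\mu$, then $L^TH_m'(\sigma)R=L^TH'(\sigma)R$.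
   Context: $M^{-T}$ denotes $(M^{-1})^T$ (plain transpose, no conjugation). $\mathrm{Range}\{V_1,\dots,V_m\}$ denotes the column space of $[V_1,\dots,V_m]$ (over $\mathbb{C}$ when $\sigma$ or $\mu$ is non-real), and similarly for $W$. $H'$ and $H_m'$ denote derivatives with respect to $\omega$. *)

(* Defs.v *)
From HB Require Import structures.
From mathcomp Require Import all_boot all_order all_algebra complex.
From mathcomp Require Import all_classical all_reals all_analysis.

Set Implicit Arguments.
Unset Strict Implicit.
Unset Printing Implicit Defensive.

Import Order.TTheory GRing.Theory Num.Theory.
Import numFieldNormedType.Exports.

Local Open Scope ring_scope.

(* F[i] packed as a numFieldType: the topology and normed-module instances of
   MathComp-Analysis are found on the sort of a numFieldType, not on the bare
   type F[i]. *)
Definition cplx (F : realType) : numFieldType := F[i]%C.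

Definition cmx (F : realType) (m n : nat) (M : 'M[F]_(m, n)) :
    'M[cplx F]_(m, n) :=
  map_mx (real_complex F) M.

Definition transfer (K : fieldType) (n p : nat)
    (A : 'M[K]_n) (B : 'M[K]_(n, p)) (C : 'M[K]_(p, n)) (w : K) : 'M[K]_p :=
  C *m invmx (w%:M - A) *m B.

(* MathComp's (_ <= _)%MS compares row spaces; this is the column space. *)
Definition in_range (K : fieldType) (n k : nat) (M : 'M[K]_(n, k))
    (x : 'cV[K]_n) : Prop :=
  exists y : 'cV[K]_k, x = M *m y.

Definition full_rank (K : fieldType) (n k : nat) (M : 'M[K]_(n, k)) : Prop :=
  \rank M = minn n k.

(* Main.v *)
Require Import Defs.
From HB Require Import structures.
From mathcomp Require Import all_boot all_order all_algebra complex.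
From mathcomp Require Import all_classical all_reals all_analysis.

(** The reduced pencil is the compression of the full one: since [W^T V = 1],
    [w - W^T A V = W^T (w - A) V].  Hence when the solution [(w - A)^-1 B R] of
    the full system lies in the range of [V], say it is [V Y], its coordinates
    [Y] solve the reduced system, i.e. [(w - A_m)^-1 B_m R = Y]
    ([reduced_solution]); multiplying by [C_m = C V] gives the right tangential
    interpolation.  Dually, if [L^T C (w - A)^-1 = Z W^T], then
    [L^T C_m (w - A_m)^-1 = Z] ([reduced_cosolution]), which gives the left one.

    For the derivatives, the resolvent identity yields
    [H'(w) = - C (w - A)^-1 (w - A)^-1 B] ([derive1_transfer]), and likewise
    for [H_m].  When both range conditions hold at the same point,
    [L^T H'(w) R = - (Z W^T) (V Y) = - Z Y], and [- Z Y] is also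
    [L^T H_m'(w) R].

    The only analytic input is the continuity of the resolvent, needed for the
    limit of the difference quotients: by Cramer's rule the entries of
    [(w - A)^-1] are polynomials in [w] divided by the characteristic
    polynomial of [A]. *)

Set Implicit Arguments.
Unset Strict Implicit.
Unset Printing Implicit Defensive.

Import Order.TTheory GRing.Theory Num.Theory.
Import numFieldNormedType.Exports.

Local Open Scope ring_scope.

(** * Compression of a linear system *)

Section Compression.
Variables (K : fieldType) (n p k s : nat).
Variables (A : 'M[K]_n) (V W : 'M[K]_(n, k)) (w : K).
Hypothesis WV1 : W^T *m V = 1%:M.

Lemma reduced_pencil : w%:M - W^T *m A *m V = W^T *m (w%:M - A) *m V.
Proof.
by rewrite mulmxBr mulmxBl mul_mx_scalar -scalemxAl WV1 scalemx1.
Qed.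

Hypothesis uA : w%:M - A \in unitmx.
Hypothesis uAm : w%:M - W^T *m A *m V \in unitmx.

(** Applying [W^T (w - A)] to [(w - A)^-1 X = V Y] gives
    [W^T X = (w - A_m) Y]. *)
Lemma reduced_solution (X : 'M[K]_(n, s)) (Y : 'M[K]_(k, s)) :
  invmx (w%:M - A) *m X = V *m Y ->
  invmx (w%:M - W^T *m A *m V) *m (W^T *m X) = Y.
Proof.
move=> XY; rewrite -[RHS](mulKmx uAm); congr (_ *m _).
by rewrite reduced_pencil -!mulmxA -XY mulKVmx.
Qed.

Lemma reduced_cosolution (X : 'M[K]_(s, n)) (Z : 'M[K]_(s, k)) :
  X *m invmx (w%:M - A) = Z *m W^T ->
  X *m V *m invmx (w%:M - W^T *m A *m V) = Z.
Proof.
move=> XZ; rewrite -[RHS](mulmxK uAm); congr (_ *m _).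
by rewrite reduced_pencil !mulmxA -XZ mulmxKV.
Qed.

End Compression.

Lemma in_range_cols (K : fieldType) (n k s : nat) (M : 'M[K]_(n, k))
    (X : 'M[K]_(n, s)) :
  (forall i, in_range M (col i X)) -> exists Y : 'M[K]_(k, s), X = M *m Y.
Proof.
move=> /fin_all_exists[y yP]; exists (\matrix_(i, j) y j i ord0).
apply/matrixP => i j; have /matrixP/(_ i ord0) := yP j; rewrite !mxE => ->.
by apply: eq_bigr => l _; rewrite mxE.
Qed.

(** * Continuity and derivative of the resolvent *)

Section MatrixLimits.
Variables (K : numFieldType) (T : Type) (F : set_system T).
Context {FF : Filter F}.
Local Open Scope classical_set_scope.

Lemma cvg_mx (m n : nat) (f : T -> 'M[K]_(m, n)) (l : 'M[K]_(m, n)) :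
  (forall i j, f t i j @[t --> F] --> l i j) -> f @ F --> l.
Proof.
move=> fl A [P Pl sPA]; apply: (@filterS _ F _ _ _ (fun t => sPA (f t))).
by apply: filter_forall => i; apply: filter_forall => j; apply/fl/Pl.
Qed.

Lemma cvg_mulmx (m n q : nat) (f : T -> 'M[K]_(m, n)) (g : T -> 'M[K]_(n, q))
    (a : 'M[K]_(m, n)) (b : 'M[K]_(n, q)) :
  f @ F --> a -> g @ F --> b -> f t *m g t @[t --> F] --> a *m b.
Proof.
move=> fa gb; apply: cvg_mx => i j; rewrite mxE.
under eq_fun do rewrite mxE.
apply: cvg_big => [|l _]; first exact: add_continuous.
apply: cvgM.
- exact: (cvg_comp _ _ fa (@coord_continuous _ _ _ i l a)).
- exact: (cvg_comp _ _ gb (@coord_continuous _ _ _ l j b)).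
Qed.

End MatrixLimits.

(** Only the norm of [K] enters, not a total order, so this covers complex
    polynomials. *)
Lemma continuous_horner_num (K : numFieldType) (q : {poly K}) :
  continuous (horner q).
Proof.
move=> x; elim/poly_ind: q => [|q c IHq].
  have -> : horner 0 = cst 0 :> (K -> K) by apply/funext => y; rewrite horner0.
  exact: cst_continuous.
have -> : horner (q * 'X + c%:P) = (fun y => q.[y] * y) + cst c :> (K -> K).
  by apply/funext => y; rewrite hornerMXaddC.
apply: continuousD; last exact: cst_continuous.
exact: continuousM.
Qed.

Section Resolvent.
Variables (K : numFieldType) (n p : nat) (A : 'M[K]_n).
Local Open Scope classical_set_scope.

Lemma horner_char_poly_mx w :
  map_mx (horner_eval w) (char_poly_mx A) = w%:M - A.
Proof.
by apply/matrixP => i j; rewrite !mxE /horner_eval !hornerE hornerMn hornerX.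
Qed.

Lemma horner_char_poly w : (char_poly A).[w] = \det (w%:M - A).
Proof. by rewrite -horner_char_poly_mx det_map_mx. Qed.

Lemma pencil_unit w : (w%:M - A \in unitmx) = ((char_poly A).[w] != 0).
Proof. by rewrite unitmxE horner_char_poly unitfE. Qed.

Lemma near_pencil_unit w :
  w%:M - A \in unitmx -> \forall z \near w, z%:M - A \in unitmx.
Proof.
rewrite pencil_unit => /(cvgr_neq0 _ (@continuous_horner_num _ (char_poly A) w)).
by apply: filterS => z; rewrite pencil_unit.
Qed.

(** Cramer's rule: the adjugate of [z - A] is the value at [z] of the polynomial
    adjugate of [char_poly_mx A], so each entry of the inverse is a quotient of
    two polynomial functions. *)
Lemma continuous_resolvent w : w%:M - A \in unitmx ->
  invmx (z%:M - A) @[z --> w] --> invmx (w%:M - A).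
Proof.
move=> uw; pose D z := (char_poly A).[z]^-1 *:
  map_mx (horner_eval z) (\adj (char_poly_mx A)).
have invE z : z%:M - A \in unitmx -> invmx (z%:M - A) = D z.
  move=> uz.
  by rewrite /invmx uz /D map_mx_adj horner_char_poly_mx horner_char_poly.
have cD : D z @[z --> w] --> D w.
  apply: (@cvg_mx _ _ _ (nbhs_filter w)) => i j.
  under eq_fun do rewrite !mxE.
  rewrite !mxE; apply: cvgM; last exact: continuous_horner_num.
  by apply: cvgV; [rewrite -pencil_unit|exact: continuous_horner_num].
rewrite invE //; apply: cvg_trans cD; apply: (near_eq_cvg (FF := nbhs_filter w)).
by apply: filterS (near_pencil_unit uw) => z uz; rewrite invE.
Qed.

Lemma resolvent_identity z w : z%:M - A \in unitmx -> w%:M - A \in unitmx ->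
  invmx (z%:M - A) - invmx (w%:M - A) =
  - ((z - w) *: (invmx (z%:M - A) *m invmx (w%:M - A))).
Proof.
move=> uz uw; rewrite -scaleNr opprB -mul_scalar_mx mulmxA -scalar_mxC.
have -> : invmx (z%:M - A) *m (w - z)%:M =
    invmx (z%:M - A) *m (w%:M - A) - 1%:M.
  rewrite -(mulVmx uz) -mulmxBr; congr (_ *m _).
  by rewrite raddfB /= opprB addrA subrK.
by rewrite mulmxBl mulmxK // mul1mx.
Qed.

(** By the resolvent identity, the difference quotient of the resolvent at [w] is
    exactly [- (h + w - A)^-1 (w - A)^-1] once [h + w - A] is invertible, which
    holds for [h] near [0]; continuity then gives the limit. *)
Lemma derive1_transfer (B : 'M[K]_(n, p)) (C : 'M[K]_(p, n)) w :
  w%:M - A \in unitmx ->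
  derive1 (transfer A B C) w =
  - (C *m (invmx (w%:M - A) *m invmx (w%:M - A)) *m B).
Proof.
move=> uw; apply/cvg_lim; first exact: norm_hausdorff.
rewrite -[- (C *m _ *m B)]mulNmx -[- (C *m _)]mulmxN.
have shift : h + w @[h --> 0^'] --> w.
  have sh : h + w @[h --> (0 : K)] --> 0 + w.
    exact: (@continuousD _ _ K id (cst w) 0 (fun _ => id)
              (@cst_continuous _ _ w 0)).
  rewrite add0r in sh; apply: cvg_trans sh; apply: cvg_app.
  exact: nbhs_dnbhs.
have quotient_cvg :
    C *m (- (invmx ((h + w)%:M - A) *m invmx (w%:M - A))) *m B
    @[h --> (0 : K)^'] -->
    C *m (- (invmx (w%:M - A) *m invmx (w%:M - A))) *m B.
  apply: cvg_mulmx; last exact: cvg_cst.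
  apply: cvg_mulmx; first exact: cvg_cst.
  apply: cvgN; apply: cvg_mulmx; last exact: cvg_cst.
  exact: (cvg_comp _ _ shift (continuous_resolvent uw)).
apply: cvg_trans quotient_cvg.
apply: (near_eq_cvg (FF := dnbhs_filter (0 : K))); near=> h.
have uh : (h + w)%:M - A \in unitmx.
  by near: h; exact: (shift _ (near_pencil_unit uw)).
have h0 : h != 0 by near: h; exact: nbhs_dnbhs_neq.
rewrite /transfer -mulmxBl -mulmxBr resolvent_identity // addrK -scalerN.
by rewrite -scalemxAr -scalemxAl scalerA mulVf // scale1r.
Unshelve. all: by end_near. Qed.

End Resolvent.

(** * Tangential interpolation *)

Section Interpolation.
Variables (K : numFieldType) (n p k s : nat).
Variables (A : 'M[K]_n) (B : 'M[K]_(n, p)) (C : 'M[K]_(p, n)).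
Variables (V W : 'M[K]_(n, k)) (w : K) (R L : 'M[K]_(p, s)).
Hypothesis WV1 : W^T *m V = 1%:M.
Hypothesis uA : w%:M - A \in unitmx.
Hypothesis uAm : w%:M - W^T *m A *m V \in unitmx.

Let H := transfer A B C.
Let Hm := transfer (W^T *m A *m V) (W^T *m B) (C *m V).

Lemma right_interpolation (Y : 'M[K]_(k, s)) :
  invmx (w%:M - A) *m (B *m R) = V *m Y -> Hm w *m R = H w *m R.
Proof.
move=> VY; have := reduced_solution WV1 uA uAm VY.
by rewrite /Hm /H /transfer -!mulmxA VY => ->.
Qed.

Lemma left_interpolation (Z : 'M[K]_(s, k)) :
  L^T *m C *m invmx (w%:M - A) = Z *m W^T -> L^T *m Hm w = L^T *m H w.
Proof.
move=> ZW; have := reduced_cosolution WV1 uA uAm ZW.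
by rewrite /Hm /H /transfer !mulmxA ZW => ->.
Qed.

Lemma bitangential_interpolation (Y : 'M[K]_(k, s)) (Z : 'M[K]_(s, k)) :
  invmx (w%:M - A) *m (B *m R) = V *m Y ->
  L^T *m C *m invmx (w%:M - A) = Z *m W^T ->
  L^T *m derive1 Hm w *m R = L^T *m derive1 H w *m R.
Proof.
move=> VY ZW; rewrite /Hm /H !derive1_transfer // !mulmxN !mulNmx; congr (- _).
have mY := reduced_solution WV1 uA uAm VY.
have mZ := reduced_cosolution WV1 uA uAm ZW.
(* Both sides equal Z *m Y, the full one through W^T *m V = 1. *)
transitivity (Z *m Y).
  by rewrite -mZ -mY !mulmxA.
transitivity ((Z *m W^T) *m (V *m Y)).
  by rewrite mulmxA -(mulmxA Z) WV1 mulmx1.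
by rewrite -ZW -VY !mulmxA.
Qed.

End Interpolation.

(* The matrices [V_1, ..., V_m] and [W_1, ..., W_m] have \sum_(i < m) s
   columns, the width given by \mxrow; this number is m * s. *)
Theorem theorem3p2 (F : realType) (n p m s : nat)
    (A : 'M[F]_n) (B : 'M[F]_(n, p)) (C : 'M[F]_(p, n))
    (V W : 'I_m -> 'M[F]_(n, s)) (sigma mu : cplx F) (R L : 'M[F]_(p, s)) :
  let Vm : 'M[F]_(n, \sum_(i < m) s) := \mxrow_(i < m) V i in
  let Wm : 'M[F]_(n, \sum_(i < m) s) := \mxrow_(i < m) W i in
  let Am := Wm^T *m A *m Vm in
  let Bm := Wm^T *m B in
  let Cm := C *m Vm in
  let H : cplx F -> 'M[cplx F]_p := transfer (cmx A) (cmx B) (cmx C) in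
  let Hm : cplx F -> 'M[cplx F]_p := transfer (cmx Am) (cmx Bm) (cmx Cm) in
  let hypR := forall i : 'I_s,
    in_range (cmx Vm) (invmx (sigma%:M - cmx A) *m cmx B *m cmx (col i R)) in
  let hypL := forall i : 'I_s,
    in_range (cmx Wm) ((invmx (mu%:M - cmx A))^T *m (cmx C)^T *m cmx (col i L))
  in
  full_rank Vm -> full_rank Wm -> Wm^T *m Vm = 1%:M ->
  sigma%:M - cmx A \in unitmx -> mu%:M - cmx A \in unitmx ->
  sigma%:M - cmx Am \in unitmx -> mu%:M - cmx Am \in unitmx ->
  [/\ hypR -> Hm sigma *m cmx R = H sigma *m cmx R,
      hypL -> (cmx L)^T *m Hm mu = (cmx L)^T *m H mu
    & hypR -> hypL -> sigma = mu ->
      (cmx L)^T *m derive1 Hm sigma *m cmx R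
      = (cmx L)^T *m derive1 H sigma *m cmx R].
Proof.
move=> Vm Wm Am Bm Cm H Hm hypR hypL _ _ WV1 uAs uAu uAms uAmu.
have cWV1 : (cmx Wm)^T *m cmx Vm = 1%:M.
  by rewrite /cmx map_trmx -map_mxM WV1 map_mx1.
have AmE : cmx Am = (cmx Wm)^T *m cmx A *m cmx Vm.
  by rewrite /cmx !map_mxM -map_trmx.
have HmE : Hm = transfer ((cmx Wm)^T *m cmx A *m cmx Vm)
    ((cmx Wm)^T *m cmx B) (cmx C *m cmx Vm).
  by rewrite /Hm AmE /cmx !map_mxM -map_trmx.
rewrite AmE in uAms uAmu; rewrite HmE.
have cmx_col (M : 'M[F]_(p, s)) i : cmx (col i M) = col i (cmx M).
  by rewrite /cmx map_col.
have solR : hypR -> exists Y,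
    invmx (sigma%:M - cmx A) *m (cmx B *m cmx R) = cmx Vm *m Y.
  move=> hR; apply: in_range_cols => i.
  by have := hR i; rewrite cmx_col !colE !mulmxA.
have solL : hypL -> exists Z,
    (cmx L)^T *m cmx C *m invmx (mu%:M - cmx A) = Z *m (cmx Wm)^T.
  move=> hL; have [i|Z ZP] := @in_range_cols _ _ _ _ (cmx Wm)
      ((invmx (mu%:M - cmx A))^T *m (cmx C)^T *m cmx L).
    by have := hL i; rewrite cmx_col !colE !mulmxA.
  exists Z^T; apply: trmx_inj; rewrite !trmx_mul !trmxK mulmxA.
  exact: ZP.
split.
- by move=> /solR[Y VY]; exact: right_interpolation VY.
- by move=> /solL[Z ZW]; exact: left_interpolation ZW.
- move=> /solR[Y VY] /solL[Z ZW] smu; rewrite -smu in ZW.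
  exact: bitangential_interpolation VY ZW.
Qed.
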